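(* Let $(E,\omega)$ be a locally finite weighted graph. Then there exists a canonical $*$-isomorphism $$\Phi_1\colon L_1(E,\omega)\longrightarrow LV(E(\omega)_1,C(\omega)^1)$$ such that $\Phi_1(v)=p_v$ for $v\in E^0$ and $\Phi_1(e_i)=\tau(\alpha^i(e),\alpha^e(i))$ for $e\in E^1$ and $1\le i\le\omega(e)$. In particular, $L_1(E,\omega)$ is isomorphic to the upper Leavitt path algebra of a (bipartite) separated graph.
   Context: Fix a field $K$ with an involution $*$. All algebras are $*$-algebras over $K$ (not necessarily unital), and all presentations are taken in the category of $*$-algebras. A directed graph is $E=(E^0,E^1,r,s)$; it is row-finite if all $s^{-1}(v)$ are finite, locally finite if all $s^{-1}(v)$ and $r^{-1}(v)$ are finite. $E^0_{\mathrm{reg}}=\{v: s^{-1}(v)\ne\emptyset\}$ (for $E$ row-finite). A weighted graph $(E,\omega)$ is a row-finite graph $E$ with no isolated vertices (no $v$ with $s^{-1}(v)=r^{-1}(v)=\emptyset$) with a map $\omega\colon E^1\to\mathbb N=\{1,2,\dots\}$; it is locally finite if $E$ is. Put $\omega(v)=\max\{\omega(e):e\in s^{-1}(v)\}$ for $v\in E^0_{\mathrm{reg}}$ and $\omega(v)=0$ for a sink $v$. $L_1(E,\omega)$ is the $*$-algebra generated by $\{v,e_i\mid v\in E^0,e\in E^1,1\le i\le\omega(e)\}$ subject to: (1) $uv=\delta_{u,v}u$, $v=v^*$ for $u,v\in E^0$; (2) $s(e)e_i=e_i=e_ir(e)$; (3) $e_ie_j^*=0$ for $e\in E^1$, $1\le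 i,j\le\omega(e)$, $i\ne j$; (4) $e_i^*f_i=0$ for $e,f\in s^{-1}(v)$, $e\neq f$, $v\in E^0$, $1\le i\le\min\{\omega(e),\omega(f)\}$; (5) $\sum_{e\in s^{-1}(v),\,\omega(e)\ge i}e_ie_i^*=v$ for $v\in E^0_{\mathrm{reg}}$, $1\le i\le\omega(v)$; (6) $\sum_{1\le i\le\omega(e)}e_i^*e_i=r(e)$ for $e\in E^1$. A separated graph is a pair $(F,D)$ with $F$ a directed graph and $D=\bigcup_{v\in F^0}D_v$, $D_v$ a partition of $s^{-1}(v)$ into nonempty subsets. It is bipartite if $F^0=F^{0,0}\sqcup F^{0,1}$ with $s(F^1)\subseteq F^{0,0}$, $r(F^1)\subseteq F^{0,1}$. For a row-finite bipartite separated graph $(F,D)$ with $s(F^1)=F^{0,0}$, $r(F^1)=F^{0,1}$, the upper Leavitt path algebra $LV(F,D)$ is the universal $*$-algebra with generators $\{p_v\}_{v\in F^{0,0}}$ and $\{\tau(e,f): e,f\in F^1,\ r(e)=r(f)\}$ and relations: $p_vp_{v'}=\delta_{v,v'}p_v$, $p_v^*=p_v$; $\tau(e,f)^*=\tau(f,e)$; $\tau(e,f)p_{s(f)}=p_{s(e)}\tau(e,f)=\tau(e,f)$; $\tau(e,f)\tau(g,h)=\delta_{f,g}\tau(e,h)$ for $f,g$ in the same set $Y\in D$; $p_v=\sum_{e\in Y}\tau(e,e)$ for $v\in F^{0,0}$, $Y\in D_v$. (Equivalently, it is the corner $VL(F,D)V$ of the Leavitt path algebra of $(F,D)$, $V=\sum_{v\in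 F^{0,0}}v$, with $p_v=v$, $\tau(e,f)=ef^*$.) For a locally finite weighted graph $(E,\omega)$, the bipartite separated graph $(E(\omega)_1,C(\omega)^1)$ has $E(\omega)_1^{0,0}=E^0$, $E(\omega)_1^{0,1}=\{v(e,i):e\in E^1,1\le i\le\omega(e)\}$, and for $v\in E^0$, $C(\omega)^1_v=\{X(v,1),\dots,X(v,\omega(v))\}\cup\{X(e)\mid e\in E^1,r(e)=v\}$, where for $1\le i\le\omega(v)$, $X(v,i)=\{\alpha^i(e): e\in s^{-1}(v),\ \omega(e)\ge i\}$ with $s(\alpha^i(e))=s(e)=v$, $r(\alpha^i(e))=v(e,i)$; and for $e\in E^1$ with $r(e)=v$, $X(e)=\{\alpha^e(i):1\le i\le\omega(e)\}$ with $s(\alpha^e(i))=r(e)=v$, $r(\alpha^e(i))=v(e,i)$. All the listed edges are pairwise distinct and form $E(\omega)_1^1$. *)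

(* Defs.v *)
From HB Require Import structures.
From mathcomp Require Import all_boot all_order all_algebra.
From mathcomp Require Import finmap.
From mathcomp Require Import mathcomp_extra boolp classical_sets functions.
From mathcomp Require Import cardinality fsbigop.

Set Implicit Arguments.
Unset Strict Implicit.
Unset Printing Implicit Defensive.

Import GRing.Theory.
Local Open Scope classical_set_scope.
Local Open Scope ring_scope.

HB.mixin Record Field_hasInvolution K of GRing.Field K := {
  invol : K -> K;
  involD : {morph invol : x y / x + y};
  involM : {morph invol : x y / x * y};
  involK : involutive invol
}.

#[short(type="involFieldType")]
HB.structure Definition InvolField :=
  {K of GRing.Field K & Field_hasInvolution K}.

Reserved Notation "x ** y" (at level 40, left associativity).

(* Associative *-algebras, without unit; `invol` acts on the scalars. *)
HB.mixin Record Lmodule_isStarAlgebra (K : involFieldType) A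
    of GRing.Lmodule K A := {
  smul : A -> A -> A;
  star : A -> A;
  smulA : associative smul;
  smulDl : left_distributive smul +%R;
  smulDr : right_distributive smul +%R;
  smulZl : forall (a : K) x y, smul (a *: x) y = a *: smul x y;
  smulZr : forall (a : K) x y, smul x (a *: y) = a *: smul x y;
  starD : {morph star : x y / x + y};
  starZ : forall (a : K) x, star (a *: x) = invol a *: star x;
  starM : forall x y, star (smul x y) = smul (star y) (star x);
  starK : involutive star
}.

#[short(type="starAlgType")]
HB.structure Definition StarAlgebra (K : involFieldType) :=
  {A of GRing.Lmodule K A & Lmodule_isStarAlgebra K A}.

Notation "x ** y" := (smul x y) : ring_scope.

Definition star_hom (K : involFieldType) (A B : starAlgType K) (f : A -> B) :=
  [/\ linear f, {morph f : x y / x ** y} & {morph f : x / star x}].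

Definition star_iso (K : involFieldType) (A B : starAlgType K) (f : A -> B) :=
  star_hom f /\ bijective f.

Definition star_isomorphic (K : involFieldType) (A B : starAlgType K) :=
  exists f : A -> B, star_iso f.

(* Presentations in the category of *-algebras: formal *-expressions modulo   *)
(* the congruence generated by the *-algebra axioms and by the relations R.   *)
Inductive term (K X : Type) : Type :=
| TGen of X
| TZero
| TAdd of term K X & term K X
| TScale of K & term K X
| TMul of term K X & term K X
| TStar of term K X.

Arguments TGen {K X}.
Arguments TZero {K X}.

HB.instance Definition _ (K X : Type) := gen_eqMixin (term K X).
HB.instance Definition _ (K X : Type) := gen_choiceMixin (term K X).

Inductive term_eq (K : involFieldType) (X : Type)
    (R : term K X -> term K X -> Prop) : term K X -> term K X -> Prop :=
| te_rel t u : R t u -> term_eq R t u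
| te_refl t : term_eq R t t
| te_sym t u : term_eq R t u -> term_eq R u t
| te_trans t u w : term_eq R t u -> term_eq R u w -> term_eq R t w
| te_add t t' u u' : term_eq R t t' -> term_eq R u u' ->
    term_eq R (TAdd t u) (TAdd t' u')
| te_scale a t t' : term_eq R t t' -> term_eq R (TScale a t) (TScale a t')
| te_mul t t' u u' : term_eq R t t' -> term_eq R u u' ->
    term_eq R (TMul t u) (TMul t' u')
| te_star t t' : term_eq R t t' -> term_eq R (TStar t) (TStar t')
| te_addA t u w : term_eq R (TAdd t (TAdd u w)) (TAdd (TAdd t u) w)
| te_addC t u : term_eq R (TAdd t u) (TAdd u t)
| te_add0 t : term_eq R (TAdd TZero t) t
| te_addN t : term_eq R (TAdd (TScale (-1) t) t) TZero
| te_scaleA a b t : term_eq R (TScale a (TScale b t)) (TScale (a * b) t)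
| te_scale1 t : term_eq R (TScale 1 t) t
| te_scaleDr a t u :
    term_eq R (TScale a (TAdd t u)) (TAdd (TScale a t) (TScale a u))
| te_scaleDl a b t :
    term_eq R (TScale (a + b) t) (TAdd (TScale a t) (TScale b t))
| te_mulA t u w : term_eq R (TMul t (TMul u w)) (TMul (TMul t u) w)
| te_mulDl t u w : term_eq R (TMul (TAdd t u) w) (TAdd (TMul t w) (TMul u w))
| te_mulDr t u w : term_eq R (TMul t (TAdd u w)) (TAdd (TMul t u) (TMul t w))
| te_mulZl a t u : term_eq R (TMul (TScale a t) u) (TScale a (TMul t u))
| te_mulZr a t u : term_eq R (TMul t (TScale a u)) (TScale a (TMul t u))
| te_starD t u : term_eq R (TStar (TAdd t u)) (TAdd (TStar t) (TStar u))
| te_starZ a t :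
    term_eq R (TStar (TScale a t)) (TScale (invol a) (TStar t))
| te_starM t u : term_eq R (TStar (TMul t u)) (TMul (TStar u) (TStar t))
| te_starK t : term_eq R (TStar (TStar t)) t.

Section TermQuotient.
Local Open Scope quotient_scope.
Variables (K : involFieldType) (X : Type) (R : term K X -> term K X -> Prop).
Implicit Types t u w : term K X.

Definition term_eqb : rel (term K X) := fun t u => `[< term_eq R t u >].

Lemma term_eqb_equiv : equiv_class_of term_eqb.
Proof.
split=> [t|t u|u t w].
- by apply/asboolP; exact: te_refl.
- by apply/asboolP/asboolP; exact: te_sym.
- by move=> /asboolP tu /asboolP uw; apply/asboolP; exact: te_trans tu uw.
Qed.

Canonical term_eqb_equivRel := EquivRelPack term_eqb_equiv.
Canonical term_eqb_encModRel := defaultEncModRel term_eqb.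

Definition term_quot := {eq_quot term_eqb}.
HB.instance Definition _ : EqQuotient (term K X) term_eqb term_quot :=
  EqQuotient.on term_quot.
HB.instance Definition _ := Choice.on term_quot.

Definition tclass t : term_quot := \pi_term_quot t.

Lemma tclassP t u : tclass t = tclass u <-> term_eq R t u.
Proof.
split; first by move/eqmodP/asboolP.
by move=> tu; apply/eqmodP/asboolP.
Qed.

Lemma tclass_repr (x : term_quot) : tclass (repr x) = x.
Proof. exact: reprK. Qed.

Lemma tclassW (P : term_quot -> Prop) :
  (forall t, P (tclass t)) -> forall x, P x.
Proof. by move=> Pt x; rewrite -(tclass_repr x). Qed.

Lemma repr_tclass t : term_eq R (repr (tclass t)) t.
Proof. by apply/tclassP; rewrite tclass_repr. Qed.

Let qadd (x y : term_quot) := tclass (TAdd (repr x) (repr y)).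
Let qscale (a : K) (x : term_quot) := tclass (TScale a (repr x)).
Let qopp (x : term_quot) := qscale (-1) x.
Let qmul (x y : term_quot) := tclass (TMul (repr x) (repr y)).
Let qstar (x : term_quot) := tclass (TStar (repr x)).

Let qaddE t u : qadd (tclass t) (tclass u) = tclass (TAdd t u).
Proof. by apply/tclassP; apply: te_add; exact: repr_tclass. Qed.
Let qscaleE a t : qscale a (tclass t) = tclass (TScale a t).
Proof. by apply/tclassP; apply: te_scale; exact: repr_tclass. Qed.
Let qmulE t u : qmul (tclass t) (tclass u) = tclass (TMul t u).
Proof. by apply/tclassP; apply: te_mul; exact: repr_tclass. Qed.
Let qstarE t : qstar (tclass t) = tclass (TStar t).
Proof. by apply/tclassP; apply: te_star; exact: repr_tclass. Qed.

Let qE := (qaddE, qscaleE, qmulE, qstarE).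

Let qaddA : associative qadd.
Proof.
elim/tclassW=> t; elim/tclassW=> u; elim/tclassW=> w.
by rewrite !qE; apply/tclassP; exact: te_addA.
Qed.

Let qaddC : commutative qadd.
Proof.
elim/tclassW=> t; elim/tclassW=> u.
by rewrite !qE; apply/tclassP; exact: te_addC.
Qed.

Let qadd0 : left_id (tclass TZero) qadd.
Proof. by elim/tclassW=> t; rewrite !qE; apply/tclassP; exact: te_add0. Qed.

Let qaddN : left_inverse (tclass TZero) qopp qadd.
Proof.
by elim/tclassW=> t; rewrite /qopp !qE; apply/tclassP; exact: te_addN.
Qed.

HB.instance Definition _ :=
  GRing.isZmodule.Build term_quot qaddA qaddC qadd0 qaddN.

Let qscaleA a b x : qscale a (qscale b x) = qscale (a * b) x.
Proof.
by elim/tclassW: x => t; rewrite !qE; apply/tclassP; exact: te_scaleA.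
Qed.

Let qscale1 : left_id 1 qscale.
Proof. by elim/tclassW=> t; rewrite !qE; apply/tclassP; exact: te_scale1. Qed.

Let qscaleDr : right_distributive qscale +%R.
Proof.
move=> a; elim/tclassW=> t; elim/tclassW=> u.
by rewrite /GRing.add/= !qE; apply/tclassP; exact: te_scaleDr.
Qed.

Let qscaleDl x : {morph qscale^~ x : a b / a + b}.
Proof.
move=> a b; elim/tclassW: x => t.
by rewrite {2}/GRing.add/= !qE; apply/tclassP; exact: te_scaleDl.
Qed.

HB.instance Definition _ := GRing.Zmodule_isLmodule.Build K term_quot
  qscaleA qscale1 qscaleDr qscaleDl.

Lemma tclassD t u : tclass (TAdd t u) = tclass t + tclass u.
Proof. exact: esym (qaddE t u). Qed.
Lemma tclass0 : tclass TZero = 0. Proof. by []. Qed.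
Lemma tclassZ a t : tclass (TScale a t) = a *: tclass t.
Proof. exact: esym (qscaleE a t). Qed.

Let qmulA : associative qmul.
Proof.
elim/tclassW=> t; elim/tclassW=> u; elim/tclassW=> w.
by rewrite !qE; apply/tclassP; exact: te_mulA.
Qed.

Let qmulDl : left_distributive qmul +%R.
Proof.
elim/tclassW=> t; elim/tclassW=> u; elim/tclassW=> w.
by rewrite !(qE, =^~ tclassD); apply/tclassP; exact: te_mulDl.
Qed.

Let qmulDr : right_distributive qmul +%R.
Proof.
elim/tclassW=> t; elim/tclassW=> u; elim/tclassW=> w.
by rewrite !(qE, =^~ tclassD); apply/tclassP; exact: te_mulDr.
Qed.

Let qmulZl (a : K) x y : qmul (a *: x) y = a *: qmul x y.
Proof.
elim/tclassW: x => t; elim/tclassW: y => u.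
by rewrite !(qE, =^~ tclassZ); apply/tclassP; exact: te_mulZl.
Qed.

Let qmulZr (a : K) x y : qmul x (a *: y) = a *: qmul x y.
Proof.
elim/tclassW: x => t; elim/tclassW: y => u.
by rewrite !(qE, =^~ tclassZ); apply/tclassP; exact: te_mulZr.
Qed.

Let qstarD : {morph qstar : x y / x + y}.
Proof.
elim/tclassW=> t; elim/tclassW=> u.
by rewrite !(qE, =^~ tclassD); apply/tclassP; exact: te_starD.
Qed.

Let qstarZ (a : K) x : qstar (a *: x) = invol a *: qstar x.
Proof.
elim/tclassW: x => t.
by rewrite !(qE, =^~ tclassZ); apply/tclassP; exact: te_starZ.
Qed.

Let qstarM x y : qstar (qmul x y) = qmul (qstar y) (qstar x).
Proof.
elim/tclassW: x => t; elim/tclassW: y => u.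
by rewrite !qE; apply/tclassP; exact: te_starM.
Qed.

Let qstarK : involutive qstar.
Proof. by elim/tclassW=> t; rewrite !qE; apply/tclassP; exact: te_starK. Qed.

HB.instance Definition _ := Lmodule_isStarAlgebra.Build K term_quot
  qmulA qmulDl qmulDr qmulZl qmulZr qstarD qstarZ qstarM qstarK.

Lemma tclassM t u : tclass (TMul t u) = tclass t ** tclass u.
Proof. exact: esym (qmulE t u). Qed.
Lemma tclass_star t : tclass (TStar t) = star (tclass t).
Proof. exact: esym (qstarE t). Qed.

End TermQuotient.

Section Presentation.
Variables (K : involFieldType) (X : Type).

Definition freeStarAlg : starAlgType K :=
  term_quot (fun _ _ : term K X => False).

Definition free_gen (x : X) : freeStarAlg := tclass _ (TGen x).

(* The *-algebra with generators X and relations a = b for rel a b. *)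
Definition starPres (rel : freeStarAlg -> freeStarAlg -> Prop) :
    starAlgType K :=
  term_quot (fun t u : term K X => rel (tclass _ t) (tclass _ u)).

Definition pres_gen (rel : freeStarAlg -> freeStarAlg -> Prop) (x : X) :
  starPres rel := tclass _ (TGen x).

End Presentation.

Arguments free_gen {K X}.
Arguments pres_gen {K X}.

Section UniversalProperty.
Variables (K : involFieldType) (X : Type).

Section Theory.
Variables A B : starAlgType K.
Lemma star_hom0 (f : A -> B) : star_hom f -> f 0 = 0.
Proof.
case=> fL _ _; have := fL (-1) 0 0.
by rewrite scaler0 addr0 scaleN1r addNr.
Qed.
Lemma star_homD (f : A -> B) : star_hom f -> {morph f : x y / x + y}.
Proof. by case=> fL _ _ x y; rewrite -[x in LHS]scale1r fL scale1r. Qed.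
Lemma star_homZ (f : A -> B) : star_hom f ->
  forall a : K, {morph f : x / a *: x}.
Proof.
by move=> fH a x; case: (fH) => fL _ _;
  rewrite -[a *: x]addr0 fL star_hom0// addr0.
Qed.
End Theory.

Fixpoint teval (A : starAlgType K) (g : X -> A) (t : term K X) : A :=
  match t with
  | TGen x => g x
  | TZero => 0
  | TAdd t u => teval g t + teval g u
  | TScale a t => a *: teval g t
  | TMul t u => teval g t ** teval g u
  | TStar t => star (teval g t)
  end.

Lemma teval_eq (R : term K X -> term K X -> Prop) (A : starAlgType K)
    (g : X -> A) :
  (forall t u, R t u -> teval g t = teval g u) ->
  forall t u, term_eq R t u -> teval g t = teval g u.
Proof.
move=> gR t u; elim=> //=.
- by move=> ? ? ? _ -> _ ->.
- by move=> ? ? ? ? _ -> _ ->.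
- by move=> ? ? ? _ ->.
- by move=> ? ? ? ? _ -> _ ->.
- by move=> ? ? _ ->.
- by move=> *; rewrite addrA.
- by move=> *; rewrite addrC.
- by move=> *; rewrite add0r.
- by move=> *; rewrite scaleN1r addNr.
- by move=> *; rewrite scalerA.
- by move=> *; rewrite scale1r.
- by move=> *; rewrite scalerDr.
- by move=> *; rewrite scalerDl.
- by move=> *; rewrite smulA.
- by move=> *; rewrite smulDl.
- by move=> *; rewrite smulDr.
- by move=> *; rewrite smulZl.
- by move=> *; rewrite smulZr.
- by move=> *; rewrite starD.
- by move=> *; rewrite starZ.
- by move=> *; rewrite starM.
- by move=> *; rewrite starK.
Qed.

Lemma term_quot_universal (R : term K X -> term K X -> Prop)
    (A : starAlgType K) (g : X -> A) :
  (forall t u, R t u -> teval g t = teval g u) ->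
  exists2 f : term_quot R -> A,
    star_hom f & forall t, f (tclass R t) = teval g t.
Proof.
move=> gR; exists (fun x => teval g (repr x)); last first.
  by move=> t; apply: teval_eq gR _ _ (repr_tclass R t).
have fE t : teval g (repr (tclass R t)) = teval g t.
  exact: teval_eq gR _ _ (repr_tclass R t).
split.
- move=> a; elim/tclassW=> t; elim/tclassW=> u.
  by rewrite -tclassZ -tclassD !fE.
- by elim/tclassW=> t; elim/tclassW=> u; rewrite -tclassM !fE.
- by elim/tclassW=> t; rewrite -tclass_star !fE.
Qed.

Lemma star_hom_teval (R : term K X -> term K X -> Prop)
    (A : starAlgType K) (f : term_quot R -> A) : star_hom f ->
  forall t, f (tclass R t) = teval (fun x => f (tclass R (TGen x))) t.
Proof.
move=> fH; elim=> //=.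
- exact: star_hom0 fH.
- by move=> t <- u <-; rewrite tclassD (star_homD fH).
- by move=> a t <-; rewrite tclassZ (star_homZ fH).
- by move=> t <- u <-; rewrite tclassM; case: fH.
- by move=> t <-; rewrite tclass_star; case: fH.
Qed.

Lemma free_universal (A : starAlgType K) (g : X -> A) :
  exists! f : freeStarAlg K X -> A,
    star_hom f /\ forall x, f (free_gen x) = g x.
Proof.
have [//|f fH fE] := @term_quot_universal (fun _ _ => False) A g.
exists f; split; first by split=> // x; rewrite fE.
move=> h [hH hE]; apply/funext; elim/tclassW=> t.
by rewrite fE star_hom_teval//; congr teval; apply/funext => x; rewrite -hE.
Qed.

Variable rel : freeStarAlg K X -> freeStarAlg K X -> Prop.

Lemma pres_proj : exists2 q : freeStarAlg K X -> starPres rel,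
  [/\ star_hom q, forall x, q (free_gen x) = pres_gen rel x
    & forall y, exists x, q x = y] &
  forall x y, rel x y -> q x = q y.
Proof.
have [//|q qH qE] :=
  @term_quot_universal (fun _ _ => False) (starPres rel) (pres_gen rel).
have qE' t : q (tclass _ t) = tclass _ t.
  rewrite qE; apply: esym.
  have idH : star_hom (id : starPres rel -> starPres rel) by split.
  exact: star_hom_teval idH t.
exists q.
  split=> //; first by move=> x; exact: qE'.
  by elim/tclassW=> t; exists (tclass _ t); exact: qE'.
elim/tclassW=> t; elim/tclassW=> u tu; rewrite !qE'.
by apply/tclassP; apply: te_rel.
Qed.

Lemma pres_universal (A : starAlgType K) (g : X -> A) :
  (forall h : freeStarAlg K X -> A, star_hom h ->
     (forall x, h (free_gen x) = g x) ->
     forall x y, rel x y -> h x = h y) ->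
  exists! f : starPres rel -> A,
    star_hom f /\ forall x, f (pres_gen rel x) = g x.
Proof.
move=> gR; have [h [[hH hE] _]] := free_universal g.
have hg t : teval g t = h (tclass _ t).
  by rewrite star_hom_teval//; congr teval; apply/funext=> x; rewrite -hE.
have [t u tu|f fH fE] := @term_quot_universal
    (fun t u => rel (tclass _ t) (tclass _ u)) A g.
  by rewrite !hg; exact: gR.
exists f; split; first by split=> // x; rewrite fE.
move=> k [kH kE]; apply/funext; elim/tclassW=> t.
by rewrite fE star_hom_teval//; congr teval; apply/funext=> x; rewrite -kE.
Qed.

End UniversalProperty.

Record digraph := Digraph {
  vertex : choiceType;
  edge : choiceType;
  src : edge -> vertex;
  rng : edge -> vertex
}.

Definition out_edges (E : digraph) (v : vertex E) : set (edge E) :=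
  [set e | src e = v].
Definition in_edges (E : digraph) (v : vertex E) : set (edge E) :=
  [set e | rng e = v].

Definition row_finite (E : digraph) :=
  forall v : vertex E, finite_set (out_edges v).
Definition locally_finite (E : digraph) :=
  forall v : vertex E, finite_set (out_edges v) /\ finite_set (in_edges v).
Definition regular (E : digraph) (v : vertex E) := out_edges v !=set0.

Record weightedGraph := WeightedGraph {
  wgraph :> digraph;
  ewt : edge wgraph -> nat;
  wgraph_row_finite : row_finite wgraph;
  wgraph_no_isolated : forall v : vertex wgraph,
    ~ (out_edges v = set0 /\ in_edges v = set0);
  ewt_gt0 : forall e, (0 < ewt e)%N
}.

(* The pairs (e, i); here and below the index i is shifted to start at 0. *)
Definition wedge (E : weightedGraph) : choiceType :=
  {e : edge E & 'I_(ewt e)}.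
Definition wpair (E : weightedGraph) (e : edge E) (i : 'I_(ewt e)) : wedge E :=
  Tagged (fun e => 'I_(ewt e)) i.

(* The empty maximum is 0, so this is 0 at sinks. *)
Definition vwt (E : weightedGraph) (v : vertex E) : nat :=
  \big[maxn/0%N]_(e \in out_edges v) ewt e.

(* The pairs (e, i) with i fixed, s(e) = v and i an admissible index of e. *)
Definition out_level (E : weightedGraph) (v : vertex E) (i : nat) :
    set (wedge E) :=
  [set p | src (tag p) = v /\ nat_of_ord (tagged p) = i].

Section L1.
Variables (K : involFieldType) (E : weightedGraph).

Inductive L1_generator : Type :=
| L1_gen_v of vertex E
| L1_gen_e of wedge E.

Let F := freeStarAlg K L1_generator.
Let V (v : vertex E) : F := free_gen (L1_gen_v v).
Let X (e : edge E) (i : 'I_(ewt e)) : F := free_gen (L1_gen_e (wpair i)).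

Inductive L1_rel : F -> F -> Prop :=
| L1_rel_vv u v : L1_rel (V u ** V v) (V u *+ (u == v))
| L1_rel_vstar v : L1_rel (V v) (star (V v))
| L1_rel_src e (i : 'I_(ewt e)) : L1_rel (V (src e) ** X i) (X i)
| L1_rel_rng e (i : 'I_(ewt e)) : L1_rel (X i) (X i ** V (rng e))
| L1_rel_ij e (i j : 'I_(ewt e)) : i <> j -> L1_rel (X i ** star (X j)) 0
| L1_rel_ef e f (i : 'I_(ewt e)) (j : 'I_(ewt f)) :
    src e = src f -> e <> f -> i = j :> nat -> L1_rel (star (X i) ** X j) 0
| L1_rel_v v i : regular v -> (i < vwt v)%N ->
    L1_rel (\sum_(p \in out_level v i) X (tagged p) ** star (X (tagged p)))
           (V v)
| L1_rel_r e : L1_rel (\sum_(i < ewt e) star (X i) ** X i) (V (rng e)).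

Definition L1 : starAlgType K := starPres L1_rel.
Definition L1_v (v : vertex E) : L1 := pres_gen L1_rel (L1_gen_v v).
Definition L1_e (e : edge E) (i : 'I_(ewt e)) : L1 :=
  pres_gen L1_rel (L1_gen_e (wpair i)).

End L1.

Record sepGraph := SepGraph {
  sgraph :> digraph;
  sep : vertex sgraph -> set (set (edge sgraph));
  sep_partition : forall v, partition (sep v) id (out_edges v)
}.

Definition sep_block (F : sepGraph) (Y : set (edge F)) :=
  exists v : vertex F, sep v Y.

(* The graphs for which LV is defined; part0 is F^{0,0}, part1 is F^{0,1}. *)
Record bipSepGraph := BipSepGraph {
  bsgraph :> sepGraph;
  part0 : set (vertex bsgraph);
  part1 : set (vertex bsgraph);
  part_setU : part0 `|` part1 = setT;
  part_setI : part0 `&` part1 = set0;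
  range_src : range (@src bsgraph) = part0;
  range_rng : range (@rng bsgraph) = part1;
  bsgraph_row_finite : row_finite bsgraph
}.

Arguments part0 : clear implicits.
Arguments part1 : clear implicits.

Section LV.
Variables (K : involFieldType) (F : bipSepGraph).

Inductive LV_generator : Type :=
| LV_gen_p v of part0 F v
| LV_gen_tau (e f : edge F) of rng e = rng f.

Let A := freeStarAlg K LV_generator.
Let P v (hv : part0 F v) : A := free_gen (LV_gen_p hv).
Let T (e f : edge F) (h : rng e = rng f) : A := free_gen (LV_gen_tau h).

Inductive LV_rel : A -> A -> Prop :=
| LV_rel_pp v w (hv : part0 F v) (hw : part0 F w) :
    LV_rel (P hv ** P hw) (P hv *+ (v == w))
| LV_rel_pstar v (hv : part0 F v) : LV_rel (star (P hv)) (P hv)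
| LV_rel_tstar e f (h : rng e = rng f) (h' : rng f = rng e) :
    LV_rel (star (T h)) (T h')
| LV_rel_src_r e f (h : rng e = rng f) (hf : part0 F (src f)) :
    LV_rel (T h ** P hf) (T h)
| LV_rel_src_l e f (h : rng e = rng f) (he : part0 F (src e)) :
    LV_rel (P he ** T h) (T h)
| LV_rel_mul_eq Y e f k (ef : rng e = rng f) (fk : rng f = rng k)
    (ek : rng e = rng k) : sep_block Y -> Y f ->
    LV_rel (T ef ** T fk) (T ek)
| LV_rel_mul_neq Y e f g k (ef : rng e = rng f) (gk : rng g = rng k) :
    sep_block Y -> Y f -> Y g -> f <> g -> LV_rel (T ef ** T gk) 0
| LV_rel_sum v Y (hv : part0 F v) : sep v Y ->
    LV_rel (P hv) (\sum_(e \in Y) T (erefl (rng e))).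

Definition LV : starAlgType K := starPres LV_rel.
Definition LV_p v (hv : part0 F v) : LV := pres_gen LV_rel (LV_gen_p hv).
Definition LV_tau (e f : edge F) (h : rng e = rng f) : LV :=
  pres_gen LV_rel (LV_gen_tau h).

End LV.

Arguments LV_p K {F v}.
Arguments LV_tau K {F e f}.

(* The bipartite separated graph (E(w)_1, C(w)^1). *)
Section E1.
Variable E : weightedGraph.

(* inl p is alpha^i(e) and inr p is alpha^e(i), for p = (e, i). *)
Definition E1_src (a : wedge E + wedge E) : vertex E + wedge E :=
  match a with inl p => inl (src (tag p)) | inr p => inl (rng (tag p)) end.
Definition E1_rng (a : wedge E + wedge E) : vertex E + wedge E :=
  match a with inl p => inr p | inr p => inr p end.

Definition E1_digraph : digraph := Digraph E1_src E1_rng.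

Definition E1_out (e : edge E) (i : 'I_(ewt e)) : edge E1_digraph :=
  inl (wpair i).
Definition E1_in (e : edge E) (i : 'I_(ewt e)) : edge E1_digraph :=
  inr (wpair i).

Definition E1_Xv (v : vertex E) (i : nat) : set (edge E1_digraph) :=
  [set inl p | p in out_level v i].
Definition E1_Xe (e : edge E) : set (edge E1_digraph) :=
  range (@E1_in e).

Definition E1_sep (x : vertex E1_digraph) : set (set (edge E1_digraph)) :=
  match x with
  | inl v => [set E1_Xv v i | i in [set i | (i < vwt v)%N]] `|`
             [set E1_Xe e | e in in_edges v]
  | inr _ => set0
  end.

Lemma vwt_ge (e : edge E) : (ewt e <= vwt (src e))%N.
Proof.
rewrite /vwt fsbig_finite/=; last exact: wgraph_row_finite.
apply: (@leq_bigmax_seq _ _ _ (@ewt E) e) => //.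
by rewrite in_fset_set ?inE//; exact: wgraph_row_finite.
Qed.

Lemma vwt_witness (v : vertex E) i : (i < vwt v)%N ->
  exists2 e, src e = v & (i < ewt e)%N.
Proof.
move=> iv; apply: contrapT => noe; move: iv; apply/negP; rewrite -leqNgt.
rewrite /vwt fsbig_finite/=; last exact: wgraph_row_finite.
apply/bigmax_leqP_seq => e; rewrite in_fset_set; last exact: wgraph_row_finite.
by rewrite inE => ev _; rewrite leqNgt; apply/negP => ie; apply: noe; exists e.
Qed.

Lemma E1_sep_partition x : partition (E1_sep x) id (out_edges x).
Proof.
case: x => [v|p]; last first.
  split=> [|? ? []|? []].
  by rewrite /cover bigcup_set0; apply/seteqP; split=> // -[].
split.
- apply/seteqP; split=> [a [_ [[i _ <-]|[e ev <-]]]|[p pv|p pv]] /=.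
  + by case=> p [pv _] <-; rewrite /out_edges/= pv.
  + by case=> i _ <-; rewrite /out_edges/= -ev.
  + case: pv => pv; exists (E1_Xv v (nat_of_ord (tagged p))); last by exists p.
    left; exists (nat_of_ord (tagged p)) => //=.
    by rewrite -pv (leq_trans (ltn_ord _))// vwt_ge.
  + case: pv => pv; exists (E1_Xe (tag p)); first by right; exists (tag p).
    by exists (tagged p) => //; case: p pv.
- move=> Y Z [[i _ <-]|[e _ <-]] [[j _ <-]|[f _ <-]] [a []].
  + by move=> [p [_ pi] <-] [q [_ qj]] [qp]; rewrite -pi -qj qp.
  + by move=> [p _ <-] [].
  + by move=> [k _ <-] [].
  + by move=> [k _ <-] [l _] [fe _]; rewrite fe.
- move=> Y [[i /= iv <-]|[e _ <-]].
    have [e ev ie] := vwt_witness iv.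
    by exists (inl (wpair (Ordinal ie))); exists (wpair (Ordinal ie)).
  by exists (E1_in (Ordinal (ewt_gt0 e))); exists (Ordinal (ewt_gt0 e)).
Qed.

Definition E1_sepGraph : sepGraph := SepGraph E1_sep_partition.

Definition E1_part0 : set (vertex E1_sepGraph) := range inl.
Definition E1_part1 : set (vertex E1_sepGraph) := range inr.

Lemma E1_part_setU : E1_part0 `|` E1_part1 = setT.
Proof.
apply/seteqP; split=> // -[v|p] _; [left|right].
  by exists v.
by exists p.
Qed.

Lemma E1_part_setI : E1_part0 `&` E1_part1 = set0.
Proof.
by apply/seteqP; split=> [_ [[v _ <-] [p _ pv]]|x []].
Qed.

Lemma E1_range_src : range (@src E1_sepGraph) = E1_part0.
Proof.
apply/seteqP; split=> [_ [[p|p] _ <-]|_ [v _ <-]]; [by eexists..|].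
have [[e /= ev]|/set0P/negP/negPn/eqP out0] := pselect (out_edges v !=set0).
  by exists (E1_out (Ordinal (ewt_gt0 e))) => //=; rewrite ev.
have [[e /= ev]|/set0P/negP/negPn/eqP in0] := pselect (in_edges v !=set0).
  by exists (E1_in (Ordinal (ewt_gt0 e))) => //=; rewrite ev.
by case: (@wgraph_no_isolated E v); split.
Qed.

Lemma E1_range_rng : range (@rng E1_sepGraph) = E1_part1.
Proof.
apply/seteqP; split=> [_ [[p|p] _ <-]|_ [p _ <-]]; [by eexists..|].
by exists (inl p).
Qed.

Lemma wedge_finite (A : set (edge E)) :
  finite_set A -> finite_set [set p : wedge E | A (tag p)].
Proof.
move=> Af; apply: (@sub_finite_set _ _ (\bigcup_(e in A) range (@wpair E e))).
  by case=> e i /= Ae; exists e => //; exists i.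
by apply: bigcup_finite => // e _; exact/finite_image/finite_finset.
Qed.

Lemma E1_row_finite : locally_finite E -> row_finite E1_sepGraph.
Proof.
move=> lfE [v|p]; last by apply: sub_finite_set (finite_set0 _); case.
have [outf inf] := lfE v.
apply: (@sub_finite_set _ _ ((inl @` [set p | out_edges v (tag p)]) `|`
  (inr @` [set p | in_edges v (tag p)]))).
  by move=> [p|p] [pv]; [left|right]; exists p.
by rewrite finite_setU; split; apply: finite_image; exact: wedge_finite.
Qed.

Definition E1_graph (lfE : locally_finite E) : bipSepGraph :=
  BipSepGraph E1_part_setU E1_part_setI E1_range_src E1_range_rng
    (E1_row_finite lfE).

Lemma E1_part0_inl (lfE : locally_finite E) (v : vertex E) :
  part0 (E1_graph lfE) (inl v).
Proof. exact: imageT. Qed.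

Lemma E1_rng_out_in (lfE : locally_finite E) (e : edge E) (i : 'I_(ewt e)) :
  @rng (E1_graph lfE) (E1_out i) = @rng (E1_graph lfE) (E1_in i).
Proof. by []. Qed.

End E1.

(* Main.v *)
Require Import Defs.
From mathcomp Require Import all_boot all_order all_algebra.
From mathcomp Require Import boolp classical_sets cardinality fsbigop.

Set Implicit Arguments.
Unset Strict Implicit.
Unset Printing Implicit Defensive.

(** Both algebras are given by generators and relations, so the isomorphism is
    obtained from two homomorphisms that are inverse to each other on
    generators.

    The map from [L1] to [LV] sends [e_i] to [tau(alpha^i(e), alpha^e(i))]. The
    relations of [L1] express what happens inside each block of the separation:
    the block [X(v,i)] accounts for [e_i^* f_i = 0] and [sum_e e_i e_i^* = v],
    the block [X(e)] for [e_i e_j^* = 0] and [sum_i e_i^* e_i = r(e)]. This is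
    [E1_tau_family].

    For the map back, the elements [tau(f,g)] behave like products [a_f a_g^*],
    where [a] assigns to every edge [f] of the bipartite graph an element
    starting at the source of [f], the product [a_f^* a_f] is a right unit on
    every [a_g] with the same range, [a_f^* a_g = 0] for distinct [f], [g] in
    one block, and [a_f a_f^*] sums to the source vertex over each block.
    Every such assignment in a *-algebra gives a homomorphism from [LV]
    ([LV_lift]). In the Leavitt path algebra of the bipartite graph the edges
    themselves are such a family, but they do not lie in the corner. Inside
    [L1] one identifies the range vertex [v(e,i)] with the final projection
    [e_i^* e_i] and takes [a = e_i] on [alpha^i(e)] and [a = e_i^* e_i] on
    [alpha^e(i)] ([E1_edge_family]). This needs [e_i e_i^* e_i = e_i], which is
    not among the relations but follows by multiplying [sum_j e_j^* e_j = r(e)]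
    on the left by [e_i] and cancelling the terms [e_i e_j^*] with [j <> i]
    ([L1_partial_isometry]).

    That identity also yields that the composite on [L1] fixes [e_i]; the
    composite on [LV] fixes [tau(f,g)] because both edges at [v(e,i)] have
    images of the form [tau(_, alpha^e(i))], and the [tau] multiply like matrix
    units over a common range vertex ([LV_tauM]). *)

Import GRing.Theory.
Local Open Scope classical_set_scope.
Local Open Scope ring_scope.

(** * Homomorphisms of *-algebras *)

Section StarAlgebraTheory.
Variables (K : involFieldType) (A B C : starAlgType K).
Implicit Types x y : A.

Lemma smul0r x : 0 ** x = 0.
Proof. by have := smulZl 0 0 x; rewrite !scale0r. Qed.

Lemma smulr0 x : x ** 0 = 0.
Proof. by have := smulZr 0 x 0; rewrite !scale0r. Qed.

Lemma smul_sumr (I : finType) x (F : I -> A) :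
  x ** (\sum_i F i) = \sum_i x ** F i.
Proof. exact: (big_morph _ (smulDr x) (smulr0 x)). Qed.

Lemma star_homMn (f : A -> B) : star_hom f ->
  forall x n, f (x *+ n) = f x *+ n.
Proof.
move=> fH x; elim=> [|n IHn]; first by rewrite !mulr0n (star_hom0 fH).
by rewrite !mulrS (star_homD fH) IHn.
Qed.

Lemma star_hom_sum (f : A -> B) : star_hom f ->
  forall (I : finType) (F : I -> A), f (\sum_i F i) = \sum_i f (F i).
Proof.
by move=> fH I F; exact: (big_morph f (star_homD fH) (star_hom0 fH)).
Qed.

(** Finiteness of [D] matters: a sum with infinite support is [0] by
    convention, and [f] may turn an infinite support into a finite one. *)
Lemma star_hom_fsum (f : A -> B) : star_hom f ->
  forall (I : choiceType) (D : set I) (F : I -> A), finite_set D ->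
  f (\sum_(i \in D) F i) = \sum_(i \in D) f (F i).
Proof.
move=> fH I D F Dfin; rewrite !fsbig_finite//.
exact: (big_morph f (star_homD fH) (star_hom0 fH)).
Qed.

Lemma star_hom_comp (f : A -> B) (g : B -> C) :
  star_hom f -> star_hom g -> star_hom (g \o f).
Proof.
move=> [fL fM fS] [gL gM gS]; split.
- by move=> a x y; rewrite /= fL gL.
- by move=> x y; rewrite /= fM gM.
- by move=> x; rewrite /= fS gS.
Qed.

Lemma star_hom_id : star_hom (@id A).
Proof. by split. Qed.

End StarAlgebraTheory.

Lemma pres_hom_ext (K : involFieldType) (X : Type) rel (A : starAlgType K)
    (f g : @starPres K X rel -> A) : star_hom f -> star_hom g ->
  (forall x, f (pres_gen rel x) = g (pres_gen rel x)) -> f =1 g.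
Proof.
move=> fH gH fg; elim/tclassW=> t; rewrite !star_hom_teval//.
by congr teval; apply/funext=> x; exact: fg.
Qed.

(** * Families satisfying the relations of a weighted graph *)

Section WeightedFamily.
Variables (K : involFieldType) (E : weightedGraph).

Record L1_family (A : starAlgType K) (P : vertex E -> A) (X : wedge E -> A) :
    Prop := L1Family {
  L1f_vv : forall u v, P u ** P v = P u *+ (u == v);
  L1f_vstar : forall v, star (P v) = P v;
  L1f_src : forall p : wedge E, P (src (tag p)) ** X p = X p;
  L1f_rng : forall p : wedge E, X p ** P (rng (tag p)) = X p;
  L1f_ij : forall e (i j : 'I_(ewt e)), i <> j ->
    X (wpair i) ** star (X (wpair j)) = 0;
  L1f_ef : forall p q : wedge E, src (tag p) = src (tag q) -> tag p <> tag q ->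
    nat_of_ord (tagged p) = nat_of_ord (tagged q) -> star (X p) ** X q = 0;
  L1f_v : forall v i, regular v -> (i < vwt v)%N ->
    \sum_(p \in out_level v i) X p ** star (X p) = P v;
  L1f_r : forall e, \sum_(i < ewt e) star (X (wpair i)) ** X (wpair i)
                    = P (rng e)
}.

(** [L1_e] indexed by the pair [(e, i)], so that a generator is a function of
    one argument without dependency. *)
Definition L1_wedge (p : wedge E) : L1 K E := pres_gen _ (L1_gen_e p).

Lemma wpair_tagged (p : wedge E) : wpair (tagged p) = p.
Proof. by case: p. Qed.

Lemma finite_out_level (v : vertex E) i : finite_set (out_level v i).
Proof.
apply: sub_finite_set (wedge_finite (@wgraph_row_finite E v)).
by move=> p [].
Qed.

Lemma L1_family_gen : L1_family (@L1_v K E) L1_wedge.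
Proof.
have [q [qH qE _] qR] := pres_proj (@L1_rel K E).
have [_ qM qS] := qH.
split.
- move=> u v; have := qR _ _ (L1_rel_vv K u v).
  by rewrite qM (star_homMn qH) !qE.
- by move=> v; have := qR _ _ (L1_rel_vstar K v); rewrite qS !qE.
- by case=> e i; have := qR _ _ (L1_rel_src K i); rewrite qM !qE.
- by case=> e i; have := qR _ _ (L1_rel_rng K i); rewrite qM !qE => <-.
- move=> e i j ij; have := qR _ _ (L1_rel_ij K ij).
  by rewrite qM qS !qE (star_hom0 qH).
- move=> [e i] [f j] /= ef nef ij; have := qR _ _ (L1_rel_ef K ef nef ij).
  by rewrite qM qS !qE (star_hom0 qH).
- move=> v i vreg iv; have := qR _ _ (L1_rel_v K vreg iv).
  rewrite (star_hom_fsum qH) ?qE; last exact: finite_out_level.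
  rewrite -/(L1_v K v) => <-; apply: eq_fsbigr => p _.
  by rewrite qM qS !qE wpair_tagged.
- move=> e; have := qR _ _ (L1_rel_r K e).
  rewrite (star_hom_sum qH) qE -/(L1_v K _) => <-; apply: eq_bigr => i _.
  by rewrite qM qS !qE.
Qed.

Lemma L1_lift (A : starAlgType K) (P : vertex E -> A) (X : wedge E -> A) :
  L1_family P X ->
  exists f : L1 K E -> A, [/\ star_hom f, forall v, f (L1_v K v) = P v
    & forall p, f (L1_wedge p) = X p].
Proof.
move=> fam.
pose g x := match x with L1_gen_v v => P v | L1_gen_e p => X p end.
have [h hH hE x y|f [[fH fE] _]] :=
  @pres_universal _ _ (@L1_rel K E) A g; last first.
  by exists f; split=> // [v|p]; exact: fE.
have [_ hM hS] := hH.
case.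
- by move=> u v; rewrite hM (star_homMn hH) !hE/= (L1f_vv fam).
- by move=> v; rewrite hS !hE/= (L1f_vstar fam).
- by move=> e i; rewrite hM !hE/= (L1f_src fam (wpair i)).
- by move=> e i; rewrite hM !hE/= (L1f_rng fam (wpair i)).
- by move=> e i j ij; rewrite hM hS !hE (star_hom0 hH)/= (L1f_ij fam).
- by move=> e f i j ef nef ij; rewrite hM hS !hE (star_hom0 hH)/= (L1f_ef fam).
- move=> v i vreg iv.
  rewrite (star_hom_fsum hH) ?hE/=; last exact: finite_out_level.
  rewrite -(L1f_v fam vreg iv); apply: eq_fsbigr => p _.
  by rewrite hM hS !hE wpair_tagged.
- move=> e; rewrite (star_hom_sum hH) hE/= -(L1f_r fam).
  by apply: eq_bigr => i _; rewrite hM hS !hE.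
Qed.

(** Multiplying the relation [sum_j e_j^* e_j = r(e)] on the left by [e_i]
    kills every term with [j <> i]. *)
Lemma L1_partial_isometry (A : starAlgType K) P X : @L1_family A P X ->
  forall p, X p ** star (X p) ** X p = X p.
Proof.
move=> fam [e i].
have := L1f_rng fam (wpair i); rewrite /= -(L1f_r fam) smul_sumr.
rewrite (bigD1 i)//= big1 ?addr0 ?smulA// => j /eqP ji.
by rewrite smulA (L1f_ij fam) ?smul0r// => ij; exact: ji.
Qed.

End WeightedFamily.

(** * Families of edges in a bipartite separated graph *)

Section LeavittFamily.
Variables (K : involFieldType) (F : bipSepGraph).
Implicit Types e f k : edge F.

(** The pattern of the edges in the Leavitt path algebra of [F], with range
    vertices left out: the projection at [rng f] is represented by
    [star (a f) ** a f], and [Lf_rng] says that it acts as a right unit on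
    every edge with the same range. *)
Record Leavitt_family (A : starAlgType K)
    (P : forall v : vertex F, part0 F v -> A) (a : edge F -> A) : Prop :=
    LeavittFamily {
  Lf_pp : forall v w (hv : part0 F v) (hw : part0 F w),
    P v hv ** P w hw = P v hv *+ (v == w);
  Lf_pstar : forall v (hv : part0 F v), star (P v hv) = P v hv;
  Lf_src : forall e (he : part0 F (src e)), P _ he ** a e = a e;
  Lf_rng : forall e f, rng e = rng f -> a e ** (star (a f) ** a f) = a e;
  Lf_neq : forall Y e f, sep_block Y -> Y e -> Y f -> e <> f ->
    star (a e) ** a f = 0;
  Lf_sum : forall v Y (hv : part0 F v), sep v Y ->
    P v hv = \sum_(e \in Y) a e ** star (a e)
}.

Lemma finite_sep_block (v : vertex F) Y : sep v Y -> finite_set Y.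
Proof.
move=> vY; apply: sub_finite_set (@bsgraph_row_finite F v).
have [<- _ _] := @sep_partition F v.
by move=> e Ye; exists Y.
Qed.

(** The homomorphism sends [tau(e,f)] to [a_e a_f^*]; the middle factor of
    [a_e (a_f^* a_g) a_k^*] is absorbed when [f = g] and vanishes when [f] and
    [g] are distinct edges of one block. *)
Lemma LV_lift (A : starAlgType K) P a : @Leavitt_family A P a ->
  exists f : LV K F -> A,
    [/\ star_hom f, forall v (hv : part0 F v), f (LV_p K hv) = P v hv
      & forall e1 e2 (h : rng e1 = rng e2),
          f (LV_tau K h) = a e1 ** star (a e2)].
Proof.
move=> fam.
pose g x := match x with
  | LV_gen_p v hv => P v hv
  | LV_gen_tau e f _ => a e ** star (a f) end.
have [h hH hE x y|f [[fH fE] _]] :=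
  @pres_universal _ _ (@LV_rel K F) A g; last first.
  by exists f; split=> // [v hv|e1 e2 h]; exact: fE.
have [_ hM hS] := hH.
case.
- by move=> v w hv hw; rewrite hM (star_homMn hH) !hE/= (Lf_pp fam).
- by move=> v hv; rewrite hS !hE/= (Lf_pstar fam).
- by move=> e f ef fe; rewrite hS !hE/= starM starK.
- move=> e f ef hf; rewrite hM !hE/= -smulA; congr (_ ** _).
  by rewrite -[in LHS](Lf_pstar fam) -starM (Lf_src fam).
- by move=> e f ef he; rewrite hM !hE/= smulA (Lf_src fam).
- move=> Y e f k ef fk ek _ _; rewrite hM !hE/=.
  by rewrite -smulA (smulA (star (a f))) smulA (Lf_rng fam).
- move=> Y e f k l ef kl bY Yf Yk fk; rewrite hM !hE (star_hom0 hH)/=.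
  by rewrite -smulA (smulA (star (a f))) (Lf_neq fam bY)// smul0r smulr0.
- move=> v Y hv vY; rewrite (star_hom_fsum hH) ?hE/=; last first.
    exact: finite_sep_block vY.
  by rewrite (Lf_sum fam hv vY); apply: eq_fsbigr => e _; rewrite hE.
Qed.

Lemma LV_pp v w (hv : part0 F v) (hw : part0 F w) :
  LV_p K hv ** LV_p K hw = LV_p K hv *+ (v == w) :> LV K F.
Proof.
have [q [qH qE _] qR] := pres_proj (@LV_rel K F).
have [_ qM _] := qH.
have := qR _ _ (LV_rel_pp K hv hw).
by rewrite qM (star_homMn qH) !qE.
Qed.

Lemma LV_pstar v (hv : part0 F v) : star (LV_p K hv) = LV_p K hv :> LV K F.
Proof.
have [q [qH qE _] qR] := pres_proj (@LV_rel K F).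
have [_ _ qS] := qH.
by have := qR _ _ (LV_rel_pstar K hv); rewrite qS !qE.
Qed.

Lemma LV_tau_star e f (ef : rng e = rng f) (fe : rng f = rng e) :
  star (LV_tau K ef) = LV_tau K fe.
Proof.
have [q [qH qE _] qR] := pres_proj (@LV_rel K F).
have [_ _ qS] := qH.
by have := qR _ _ (LV_rel_tstar K ef fe); rewrite qS !qE.
Qed.

Lemma LV_tau_p e f (ef : rng e = rng f) (hf : part0 F (src f)) :
  LV_tau K ef ** LV_p K hf = LV_tau K ef.
Proof.
have [q [qH qE _] qR] := pres_proj (@LV_rel K F).
have [_ qM _] := qH.
by have := qR _ _ (LV_rel_src_r K ef hf); rewrite qM !qE.
Qed.

Lemma LV_p_tau e f (ef : rng e = rng f) (he : part0 F (src e)) :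
  LV_p K he ** LV_tau K ef = LV_tau K ef.
Proof.
have [q [qH qE _] qR] := pres_proj (@LV_rel K F).
have [_ qM _] := qH.
by have := qR _ _ (LV_rel_src_l K ef he); rewrite qM !qE.
Qed.

Lemma sep_block_edge f : exists2 Y, sep_block Y & Y f.
Proof.
have [fY _ _] := @sep_partition F (src f).
have : out_edges (src f) f by [].
by rewrite -fY => -[Y sY Yf]; exists Y => //; exists (src f).
Qed.

(** Every edge lies in a block, so the defining relation for equal middle
    edges applies to any [f]. *)
Lemma LV_tauM e f k (ef : rng e = rng f) (fk : rng f = rng k)
    (ek : rng e = rng k) : LV_tau K ef ** LV_tau K fk = LV_tau K ek.
Proof.
have [q [qH qE _] qR] := pres_proj (@LV_rel K F).
have [_ qM _] := qH.
have [Y bY Yf] := sep_block_edge f.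
by have := qR _ _ (LV_rel_mul_eq K ef fk ek bY Yf); rewrite qM !qE.
Qed.

Lemma LV_tauM0 Y e f g k (ef : rng e = rng f) (gk : rng g = rng k) :
  sep_block Y -> Y f -> Y g -> f <> g -> LV_tau K ef ** LV_tau K gk = 0.
Proof.
move=> bY Yf Yg fg; have [q [qH qE _] qR] := pres_proj (@LV_rel K F).
have [_ qM _] := qH.
have := qR _ _ (LV_rel_mul_neq K ef gk bY Yf Yg fg).
by rewrite qM !qE (star_hom0 qH).
Qed.

Lemma LV_p_sum v Y (hv : part0 F v) : sep v Y ->
  LV_p K hv = \sum_(e \in Y) LV_tau K (erefl (rng e)).
Proof.
move=> vY; have [q [qH qE _] qR] := pres_proj (@LV_rel K F).
have := qR _ _ (LV_rel_sum K hv vY).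
rewrite qE -/(LV_p K hv) (star_hom_fsum qH) => [->|]; last first.
  exact: finite_sep_block vY.
by apply: eq_fsbigr => e _; rewrite qE.
Qed.

End LeavittFamily.

(** * The bipartite separated graph of a weighted graph *)

Section Comparison.
Variables (K : involFieldType) (E : weightedGraph).
Variable lfE : locally_finite E.
Let F := E1_graph lfE.

Lemma E1_sep_Xv (v : vertex E) i :
  (i < vwt v)%N -> @sep F (inl v) (E1_Xv v i).
Proof. by move=> iv; left; exists i. Qed.

Lemma E1_sep_Xe (e : edge E) : @sep F (inl (rng e)) (E1_Xe e).
Proof. by right; exists e. Qed.

Lemma fsum_E1_Xv (A : nmodType) v i (G : edge F -> A) :
  \sum_(a \in E1_Xv v i) G a = \sum_(p \in out_level v i) G (inl p).
Proof. by rewrite fsbig_image// => p q _ _ []. Qed.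

Lemma fsum_E1_Xe (A : nmodType) (e : edge E) (G : edge F -> A) :
  \sum_(a \in E1_Xe e) G a = \sum_(i < ewt e) G (inr (wpair i)).
Proof.
rewrite fsbig_image; last by move=> i j _ _ [] /eqP; rewrite eq_Tagged => /eqP.
rewrite [RHS](fsbig_seq _ _ (index_enum_uniq _)).
by apply: eq_fsbigl; apply/seteqP; split=> // i _ /=; rewrite mem_index_enum.
Qed.

Definition E1_tau (p : wedge E) : LV K F :=
  @LV_tau K F (inl p) (inr p) erefl.

Lemma star_E1_tau p : star (E1_tau p) = @LV_tau K F (inr p) (inl p) erefl.
Proof. exact: LV_tau_star. Qed.

(** Orthogonality in [X(e)] gives the vanishing of [e_i e_j^*], orthogonality in
    [X(v,i)] that of [e_i^* f_i], and the sums over these blocks give the two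
    summation relations. *)
Lemma E1_tau_family :
  L1_family (fun v => LV_p K (E1_part0_inl lfE v)) E1_tau.
Proof.
split.
- by move=> u v; rewrite LV_pp.
- by move=> v; exact: LV_pstar.
- by move=> p; exact: (@LV_p_tau K F (inl p) (inr p)).
- by move=> p; exact: (@LV_tau_p K F (inl p) (inr p)).
- move=> e i j ij; rewrite star_E1_tau /E1_tau.
  apply: (@LV_tauM0 K F (E1_Xe e) (inl (wpair i)) (inr (wpair i))
    (inr (wpair j)) (inl (wpair j))).
  + by exists (inl (rng e)); exact: E1_sep_Xe.
  + by exists i.
  + by exists j.
  + by move=> [] /eqP; rewrite eq_Tagged => /eqP.
- move=> p q pq npq ij; rewrite star_E1_tau /E1_tau.
  apply: (@LV_tauM0 K F (E1_Xv (src (tag p)) (tagged p)) (inr p) (inl p)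
    (inl q) (inr q)).
  + exists (inl (src (tag p))); apply: E1_sep_Xv.
    by rewrite (leq_trans (ltn_ord _))// vwt_ge.
  + by exists p.
  + by exists q.
  + by move=> [] pqE; apply: npq; rewrite pqE.
- move=> v i _ iv; rewrite (LV_p_sum K _ (E1_sep_Xv iv)) fsum_E1_Xv.
  by apply: eq_fsbigr => p _; rewrite star_E1_tau /E1_tau; exact: LV_tauM.
- move=> e; rewrite (LV_p_sum K _ (E1_sep_Xe e)) fsum_E1_Xe.
  by apply: eq_bigr => i _; rewrite star_E1_tau /E1_tau; exact: LV_tauM.
Qed.

(** The value [0] is a filler: vertices [v(e,i)] are outside [part0]. *)
Definition E1_vertex_val (A : starAlgType K) (P : vertex E -> A)
    (v : vertex F) : A := if v is inl u then P u else 0.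

(** The edges [alpha^i(e)] and [alpha^e(i)] of the Leavitt path algebra, moved
    into the corner by multiplying on the right with [alpha^e(i)^*], a
    partial isometry between the range vertex [v(e,i)] and the projection
    [e_i^* e_i]. *)
Definition E1_edge_val (A : starAlgType K) (X : wedge E -> A)
    (a : edge F) : A :=
  match a with inl p => X p | inr p => star (X p) ** X p end.

(** A product [star (a e) ** a f] on a block [X(v,i)] vanishes by the relation
    between different edges at the same level; on a block [X(e)] it contains
    the factor [e_i e_j^*]. The conditions on ranges reduce to
    [e_i e_i^* e_i = e_i]. *)
Lemma E1_edge_family (A : starAlgType K) (P : vertex E -> A) X :
  L1_family P X ->
  @Leavitt_family K F A (fun v _ => E1_vertex_val P v) (E1_edge_val X).
Proof.
move=> fam; have XXX := L1_partial_isometry fam.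
have sXXX p : star (X p) ** X p ** star (X p) = star (X p).
  by rewrite -[in RHS](XXX p) !starM starK smulA.
split.
- move=> _ _ [u _ <-] [v _ <-] /=; rewrite (L1f_vv fam).
  by congr (_ *+ _).
- by move=> _ [u _ <-] /=; exact: (L1f_vstar fam).
- move=> [p|p] _ /=; first exact: (L1f_src fam).
  by rewrite smulA -{1}(L1f_vstar fam) -starM (L1f_rng fam).
- by move=> [p|p] [q|q] [<-] /=; rewrite ?starM ?starK !smulA ?XXX ?sXXX ?XXX.
- move=> Y a b [[v|//] [[i iv <-]|[e ev <-]]].
    move=> [p [vp pi] <-] [q [vq qi] <-] pq /=.
    apply: (L1f_ef fam); [by rewrite vp vq| |by rewrite pi qi].
    (* On one level, a pair [(e, i)] is determined by its edge. *)
    move=> tpq; apply: pq; congr inl; case: p q tpq vp pi vq qi => [e j] [f k].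
    move=> /= ef; case: f / ef k => k _ jE _ kE.
    by congr existT; apply: val_inj; rewrite /= jE kE.
  move=> [i _ <-] [j _ <-] ij /=; rewrite starM starK -smulA.
  rewrite (smulA (X _)) (L1f_ij fam) ?smul0r ?smulr0// => ijE.
  by apply: ij; rewrite ijE.
- move=> _ Y [v _ <-] [[i iv <-]|[e <- <-]] /=.
    rewrite fsum_E1_Xv/= (L1f_v fam)//.
    by have [e ev _] := vwt_witness iv; exists e.
  rewrite fsum_E1_Xe/= -(L1f_r fam); apply: eq_bigr => i _.
  by rewrite starM starK !smulA sXXX.
Qed.

Lemma E1_star_iso : exists Phi : L1 K E -> LV K F,
  [/\ star_iso Phi, forall v, Phi (L1_v K v) = LV_p K (E1_part0_inl lfE v)
    & forall p, Phi (L1_wedge K p) = E1_tau p].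
Proof.
have [Phi [PhiH PhiP PhiX]] := L1_lift E1_tau_family.
have [Psi [PsiH PsiP PsiT]] := LV_lift (E1_edge_family (L1_family_gen K E)).
exists Phi; split=> //; split=> //; exists Psi.
- apply: (pres_hom_ext (star_hom_comp PhiH PsiH) (star_hom_id _)) => -[v|p] /=.
    by rewrite [Phi _]PhiP PsiP.
  rewrite [Phi _]PhiX PsiT/= starM starK smulA.
  exact: L1_partial_isometry (L1_family_gen K E) p.
- have [_ PhiM PhiS] := PhiH.
  apply: (pres_hom_ext (star_hom_comp PsiH PhiH) (star_hom_id _)).
  case=> [[v|p] hv|e f ef] /=; last 2 first.
  - by case: hv.
  (* Over [v(e,i)], both images are compared with [alpha^e(i)]; then
     [tau(e,f) = tau(e,alpha^e(i)) tau(f,alpha^e(i))^*]. *)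
  - have Phi_edge a p (ap : @rng F a = @rng F (inr p)) :
        Phi (E1_edge_val (@L1_wedge K E) a) = LV_tau K ap.
      case: a ap => q ap; case: (ap) => qp; subst q;
        rewrite /= ?PhiM ?PhiS PhiX.
        by rewrite /E1_tau; congr LV_tau; exact: Prop_irrelevance.
      by rewrite star_E1_tau (LV_tauM K _ _ ap).
    have [p fp] : exists p, @rng F f = @rng F (inr p).
      by case: (f) => p; exists p.
    rewrite [Psi _]PsiT PhiM PhiS (Phi_edge _ _ (etrans ef fp)).
    rewrite (Phi_edge _ _ fp).
    by rewrite (LV_tau_star K _ (esym fp)) (LV_tauM K _ _ ef).
  - rewrite [Psi _]PsiP/= PhiP; congr (LV_p K _); exact: Prop_irrelevance.
Qed.

End Comparison.

Theorem theorem3p12 (K : involFieldType) (E : weightedGraph)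
    (lfE : locally_finite E) :
  (exists Phi : L1 K E -> LV K (E1_graph lfE),
     [/\ star_iso Phi,
         forall v : vertex E,
           Phi (L1_v K v) = LV_p K (E1_part0_inl lfE v)
       & forall (e : edge E) (i : 'I_(ewt e)),
           Phi (L1_e K i) = LV_tau K (E1_rng_out_in lfE i)]) /\
  (exists F : bipSepGraph, star_isomorphic (L1 K E) (LV K F)).
Proof.
have [Phi [isoPhi PhiP PhiX]] := E1_star_iso K lfE.
split; last by exists (E1_graph lfE), Phi.
exists Phi; split=> // e i; rewrite [LHS](PhiX (wpair i)) /E1_tau.
congr LV_tau; exact: Prop_irrelevance.
Qed.
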